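(* The hypergraph upper closure operation is a functor $\Delta:\mathbf{MHyp}\to\mathbf{Simp}$.
   Context: $\mathbf{MHyp}$ is the category of finite hypergraphs. Objects are triples $\mathcal{H}=(V,E,\epsilon)$ with $V,E$ finite sets and $\epsilon:E\to\mathcal{P}(V)$ a function to the power set (multi-edges and empty edges are allowed). A morphism $(V,E,\epsilon)\to(V',E',\epsilon')$ is a pair of functions $(f_V,f_E)$ with $f_V:V\to V'$, $f_E:E\to E'$, such that $\epsilon'(f_E(e))=\{f_V(v):v\in\epsilon(e)\}$ for all $e\in E$. Composition is component-wise. $\mathbf{Simp}$ is the category of abstract simplicial complexes. An object is a collection $K$ of nonempty subsets (simplices) of a base set $X$ closed under taking nonempty subsets. A morphism from $K_1$ on $X_1$ to $K_2$ on $X_2$ is a simplicial map, i.e. a function $f:X_1\to X_2$ such that $\{f(x):x\in\sigma\}\in K_2$ for every $\sigma\in K_1$. The upper closure operation on objects sends $(V,E,\epsilon)$ to the simplicial complex on base set $V$ whose simplices are all nonempty $\sigma\subseteq V$ such that $\sigma\subseteq\epsilon(e)$ for some $e\in E$. On morphisms it sends $(f_V,f_E)$ to $f_V$. *)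

(* Defs.v *)
From mathcomp Require Import all_boot.
From mathcomp Require Import boolp classical_sets.

Set Implicit Arguments.
Unset Strict Implicit.
Unset Printing Implicit Defensive.

Local Open Scope classical_set_scope.

Record category := Category {
  obj :> Type;
  hom : obj -> obj -> Type;
  idm : forall x, hom x x;
  comp : forall x y z, hom y z -> hom x y -> hom x z;
  comp1m : forall x y (f : hom x y), comp (idm y) f = f;
  compm1 : forall x y (f : hom x y), comp f (idm x) = f;
  compA : forall w x y z (h : hom y z) (g : hom x y) (f : hom w x),
    comp h (comp g f) = comp (comp h g) f }.

Arguments idm {c} x.
Arguments comp {c x y z} g f.

Definition is_functor (C D : category) (F0 : C -> D)
    (F1 : forall x y : C, hom x y -> hom (F0 x) (F0 y)) : Prop :=
  (forall x : C, F1 x x (idm x) = idm (F0 x)) /\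
  (forall (x y z : C) (g : hom y z) (f : hom x y),
    F1 x z (comp g f) = comp (F1 y z g) (F1 x y f)).

Record hypergraph := Hypergraph {
  vertex : finType;
  edge : finType;
  incidence : edge -> {set vertex} }.

Definition hypergraph_map (G H : hypergraph)
    (fV : vertex G -> vertex H) (fE : edge G -> edge H) : Prop :=
  forall e : edge G, incidence (fE e) = fV @: incidence e.

Record hypergraph_hom (G H : hypergraph) := HypergraphHom {
  vertex_fun : vertex G -> vertex H;
  edge_fun : edge G -> edge H;
  hypergraph_homP : hypergraph_map vertex_fun edge_fun }.

Lemma hypergraph_hom_eq (G H : hypergraph) (f g : hypergraph_hom G H) :
  vertex_fun f = vertex_fun g -> edge_fun f = edge_fun g -> f = g.
Proof.
case: f g => [fV fE fP] [gV gE gP] /= eqV eqE; case: _ / eqV in gP *.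
by case: _ / eqE in gP *; rewrite (Prop_irrelevance fP gP).
Qed.

Lemma hypergraph_map_id (G : hypergraph) :
  hypergraph_map (fun v : vertex G => v) (fun e : edge G => e).
Proof. by move=> e; rewrite imset_id. Qed.

Lemma hypergraph_map_comp (G H K : hypergraph)
    (g : hypergraph_hom H K) (f : hypergraph_hom G H) :
  hypergraph_map (vertex_fun g \o vertex_fun f) (edge_fun g \o edge_fun f).
Proof. by move=> e /=; rewrite !hypergraph_homP imset_comp. Qed.

Definition MHyp : category.
Proof.
refine (@Category hypergraph hypergraph_hom
  (fun G => HypergraphHom (@hypergraph_map_id G))
  (fun G H K g f => HypergraphHom (hypergraph_map_comp g f)) _ _ _).
- by move=> G H f; apply: hypergraph_hom_eq.
- by move=> G H f; apply: hypergraph_hom_eq.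
- by move=> G H K L h g f; apply: hypergraph_hom_eq.
Defined.

(* The base set may be infinite, simplices are not required to be finite, and
   a point of the base set need not span a simplex. *)
Definition is_simplicial_complex (X : Type) (K : set (set X)) : Prop :=
  (forall s, K s -> s !=set0) /\
  (forall s t, K s -> t `<=` s -> t !=set0 -> K t).

Record simplicial_complex := SimplicialComplex {
  base : Type;
  simplices : set (set base);
  simplicial_complexP : is_simplicial_complex simplices }.

Arguments simplices K : clear implicits, rename.

Definition is_simplicial_map (X Y : Type) (K : set (set X)) (L : set (set Y))
    (f : X -> Y) : Prop :=
  forall s, K s -> L (f @` s).

Record simplicial_map (K L : simplicial_complex) := SimplicialMap {
  base_fun : base K -> base L;
  simplicial_mapP :
    is_simplicial_map (simplices K) (simplices L) base_fun }.

Lemma simplicial_map_eq (K L : simplicial_complex) (f g : simplicial_map K L) :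
  base_fun f = base_fun g -> f = g.
Proof.
case: f g => [f fP] [g gP] /= eqfg; case: _ / eqfg in gP *.
by rewrite (Prop_irrelevance fP gP).
Qed.

Lemma is_simplicial_map_id (K : simplicial_complex) :
  is_simplicial_map (simplices K) (simplices K) (fun x => x).
Proof. by move=> s Ks; rewrite image_id. Qed.

Lemma is_simplicial_map_comp (K L M : simplicial_complex)
    (g : simplicial_map L M) (f : simplicial_map K L) :
  is_simplicial_map (simplices K) (simplices M) (base_fun g \o base_fun f).
Proof.
by move=> s Ks; rewrite -image_comp; do 2!apply: simplicial_mapP.
Qed.

Definition Simp : category.
Proof.
refine (@Category simplicial_complex simplicial_map
  (fun K => SimplicialMap (@is_simplicial_map_id K))
  (fun K L M g f => SimplicialMap (is_simplicial_map_comp g f)) _ _ _).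
- by move=> K L f; apply: simplicial_map_eq.
- by move=> K L f; apply: simplicial_map_eq.
- by move=> K L M N h g f; apply: simplicial_map_eq.
Defined.

Definition upper_closure (H : hypergraph) : set (set (vertex H)) :=
  [set s | s !=set0 /\ exists e : edge H, s `<=` [set` incidence e]].

Arguments upper_closure H : clear implicits.

(* Main.v *)
Require Import Defs.
From mathcomp Require Import all_boot.
From mathcomp Require Import boolp classical_sets.

(** A hypergraph morphism sends the vertex set of [e] exactly onto that of [edge_fun f e], so a set
    lying under an edge has its image under an edge: [vertex_fun f] is simplicial. Functoriality is
    then inherited from composition of vertex functions, since a simplicial map is determined by its
    base function. *)

Lemma upper_closure_simplicial (H : hypergraph) :
  is_simplicial_complex (upper_closure H).
Proof.
split=> [s [] //|s t [_ [e se]] ts t0].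
by split=> //; exists e; apply: subset_trans se.
Qed.

Lemma upper_closure_map (G H : hypergraph) (f : hypergraph_hom G H) :
  is_simplicial_map (upper_closure G) (upper_closure H) (vertex_fun f).
Proof.
move=> s [s0 [e se]]; split; first exact: image_nonempty.
exists (edge_fun f e) => _ [v sv <-] /=.
by rewrite hypergraph_homP; apply: imset_f; apply: se.
Qed.

Theorem proposition9 :
  exists (D0 : forall H : hypergraph,
            is_simplicial_complex (upper_closure H))
         (D1 : forall (G H : hypergraph) (f : hypergraph_hom G H),
            is_simplicial_map (upper_closure G) (upper_closure H)
              (vertex_fun f)),
    @is_functor MHyp Simp
      (fun H : hypergraph => SimplicialComplex (D0 H))
      (fun (G H : hypergraph) (f : hypergraph_hom G H) =>
         @SimplicialMap (SimplicialComplex (D0 G)) (SimplicialComplex (D0 H))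
           (vertex_fun f) (D1 G H f)).
Proof.
exists upper_closure_simplicial, upper_closure_map.
(* In both laws the two base functions are convertible; only the simpliciality proofs differ, and
   [simplicial_map_eq] identifies those. *)
by split=> [H|G H K g f]; apply: simplicial_map_eq.
Qed.
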